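(* Let $V$ be a Euclidean vector space and let $(a,b)\in \mathrm{C}\ell(V)\times \mathrm{C}\ell(V)$ be a quadratic Clifford pair. Up to the normalization described next, $(a,b)$ is linear if and only if it is either of the form $(0,\beta)$ with a scalar $\beta$, or of the form $(A,A)$ with $A=A_0+iA_1\in \mathrm{C}\ell_2(V)$, $A_0,A_1$ real, such that $A_0$ and $A_1$ anti-commute when considered as (skew-symmetric) endomorphisms of $V$. Here ''up to normalization'' means: up to replacing $(a,b)$ by $(a+\alpha+\alpha_1\Gamma^*,\,b+\alpha-\alpha_1\Gamma^* )$ with scalars $\alpha,\alpha_1\in\mathbb{C}$ if $\dim V$ is even, and by $(a+\alpha,b+\alpha)$ with a scalar $\alpha$ if $\dim V$ is odd.
   Context: $V$ is an $n$-dimensional real vector space with Euclidean metric $g$; $\mathrm{C}\ell(V)$ is its complex Clifford algebra with relation $vw+wv=-2g(v,w)$. Let $\{e_\mu\}$ be an orthonormal basis, $\Gamma_\mu$ the corresponding Clifford generators, $\Gamma^*=i^{\lfloor (n+1)/2\rfloor}\Gamma_1\cdots\Gamma_n$, so $(\Gamma^* )^2=1$. $\mathrm{C}\ell(V)$ is identified with its image $\mathrm{End}(S)$ under an irreducible representation; thus if $n$ is odd, $\Gamma^*=\pm 1$. $\mathrm{C}\ell_2(V)$ is the complex span of the products $\Gamma_\mu\Gamma_\nu$, $\mu\neq\nu$; it is identified with the complex skew-symmetric endomorphisms of $V\otimes\mathbb{C}$ in such a way that $Ax-xA=A(x)$ for $A\in \mathrm{C}\ell_2(V)$, $x\in V\otimes\mathbb{C}$;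 ''real'' elements correspond to real skew-symmetric endomorphisms. For $a,b\in \mathrm{C}\ell(V)$ put $s_{a,b}(x)=ax-xb$ and $q_{a,b}=s_{a,b}\circ s_{a,b}$, i.e. $q_{a,b}(x)=a^2x+xb^2-2axb$. $(a,b)$ is a quadratic Clifford pair if $q_{a,b}(V)\subset V$ and $q_{a,b}|_V$ is $g$-symmetric. A pair $(a,b)$ is linear if $s_{a,b}(V\otimes\mathbb{C})\subset V\otimes\mathbb{C}$. *)

(* Defs.v *)
From HB Require Import structures.
From mathcomp Require Import all_boot all_order all_algebra.
From mathcomp Require Import sesquilinear reals complex.

Set Implicit Arguments.
Unset Strict Implicit.
Unset Printing Implicit Defensive.

Import GRing.Theory.
Local Open Scope ring_scope.
Local Open Scope complex_scope.

Section Clifford.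

Variables (R : realType) (n : nat) (V : vectType R) (S : vectType R[i]).
Variables (g : {dot V for idfun}) (e : n.-tuple V).

(* c is R-linear: real scalars act on 'End(S) through R -> R[i]. *)
Variable c : {linear V -> 'End(S) | real_complex R \; *:%R}.

Definition orthonormal_basis : Prop :=
  basis_of {:V} e /\
  forall i j : 'I_n, g (tnth e i) (tnth e j) = (i == j)%:R.

(* By the universal property of the Clifford algebra, such a c is the same
   thing as a representation of Cl(V) on S. When it is irreducible, its image
   is the whole of 'End(S): elements of Cl(V) are taken to be elements of
   'End(S), with product \o, and x in V is identified with c x. *)
Definition clifford_map : Prop :=
  forall v w : V,
    ((c v \o c w) + (c w \o c v))%VF = (- 2 * g v w)%:C *: \1%VF.

Definition irreducible_rep : Prop :=
  (0 < \dim {:S})%N /\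
  forall U : {vspace S}, (forall v : V, (c v @: U <= U)%VS) ->
    U = 0%VS \/ U = {:S}%VS.

Definition Gamma (i : 'I_n) : 'End(S) := c (tnth e i).

Definition Gamma_star : 'End(S) :=
  'i%C ^+ (n.+1)./2 *: \big[@comp_lfun _ S S S / \1%VF]_(i < n) Gamma i.

(* The image of the complexification of V in End(S). *)
Definition VC : {vspace 'End(S)} := <<[seq Gamma i | i : 'I_n]>>%VS.

Definition Cl2 : {vspace 'End(S)} :=
  <<[seq (Gamma i \o Gamma j)%VF
      | i <- enum 'I_n, j <- [seq j <- enum 'I_n | j != i]]>>%VS.

Definition s_map (a b x : 'End(S)) : 'End(S) := ((a \o x) - (x \o b))%VF.

Definition q_map (a b x : 'End(S)) : 'End(S) := s_map a b (s_map a b x).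

Definition quadratic_pair (a b : 'End(S)) : Prop :=
  exists2 Q : 'End(V), (forall v, q_map a b (c v) = c (Q v)) &
    forall v w, g (Q v) w = g v (Q w).

Definition linear_pair (a b : 'End(S)) : Prop :=
  forall x, x \in VC -> s_map a b x \in VC.

Definition skew_symmetric (T : 'End(V)) : Prop :=
  forall v w, g (T v) w = - g v (T w).

(* A is the real element of Cl_2(V) identified with T: A x - x A = T x. *)
Definition Cl2_real (A : 'End(S)) (T : 'End(V)) : Prop :=
  [/\ A \in Cl2, skew_symmetric T &
      forall v, ((A \o c v) - (c v \o A))%VF = c (T v)].

Definition scalar_form (a b : 'End(S)) : Prop :=
  exists beta : R[i], a = 0 /\ b = beta *: \1%VF.

Definition anticommuting_form (a b : 'End(S)) : Prop :=
  exists (A0 A1 : 'End(S)) (T0 T1 : 'End(V)),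
    [/\ Cl2_real A0 T0, Cl2_real A1 T1,
        ((T0 \o T1) + (T1 \o T0))%VF = 0,
        a = A0 + 'i%C *: A1 & b = A0 + 'i%C *: A1].

(* basis_of forces n = \dim V. *)
Definition up_to_normalization (P : 'End(S) -> 'End(S) -> Prop)
    (a b : 'End(S)) : Prop :=
  if odd n then
    exists alpha : R[i], P (a + alpha *: \1%VF) (b + alpha *: \1%VF)
  else
    exists alpha alpha1 : R[i],
      P (a + alpha *: \1%VF + alpha1 *: Gamma_star)
        (b + alpha *: \1%VF - alpha1 *: Gamma_star).

End Clifford.

(* Main.v *)
(* Write G_i for the Clifford generators and a G_j - G_j b = sum_k L_kj G_k.
   Multiplying by G_i on either side shows that d := a - b satisfies
   d G_i + G_i d = 2 L_ii G_i. Commuting d past G_i G_j = - G_j G_i then forces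
   all L_ii to be one scalar l, and d - l anticommutes with every generator, so
   by Schur's lemma it is a multiple of the volume element (zero if n is odd).
   The normalization removes it; afterwards a = b + l and x |-> b x - x b acts
   on V_C by M := L - l. Being a derivation, it annihilates G_i G_j + G_j G_i,
   so M is skew; hence b is a scalar plus the element of Cl_2 attached to M.
   Finally L^2 = M^2 + 2 l M + l^2 is real and symmetric: the skew part gives
   l M = 0, and if l = 0 the imaginary part of M^2 is the anticommutator of the
   real and imaginary parts of M. *)

Require Import Defs.
From HB Require Import structures.
From mathcomp Require Import all_boot all_order all_algebra.
From mathcomp Require Import sesquilinear reals complex.

Set Implicit Arguments.
Unset Strict Implicit.
Unset Printing Implicit Defensive.

Import GRing.Theory Num.Theory.
Local Open Scope ring_scope.

(** * Clifford relations and the volume element in an abstract algebra *)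

Section CliffordGenerators.

Variables (K : numFieldType) (A : algType K) (n : nat) (G : 'I_n -> A).
Hypothesis G_clifford :
  forall i j, G i * G j + G j * G i = (- 2 * (i == j)%:R)%:A.

Let vec (u : 'I_n -> K) : A := \sum_k u k *: G k.
Let volume : A := \prod_(i < n) G i.

Lemma alg_inj (k l : K) : k%:A = l%:A :> A -> k = l.
Proof. exact: (fmorph_inj (in_alg A)). Qed.

Lemma gen_sqr i : G i * G i = -1.
Proof.
have /(congr1 (fun x => 2^-1 *: x)) := G_clifford i i.
rewrite eqxx mulr1 -mulr2n -scaler_nat !scalerA mulrN mulVf ?pnatr_eq0 //.
by rewrite scale1r scaleN1r.
Qed.

Lemma gen_anticomm i j : i != j -> G i * G j = - (G j * G i).
Proof.
move=> /negPf ij; apply/eqP; rewrite -addr_eq0 G_clifford ij mulr0.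
by rewrite scale0r.
Qed.

Lemma gen_reg i y : G i * y = 0 -> y = 0.
Proof.
move=> /(congr1 ( *%R (G i))); rewrite mulrA gen_sqr mulN1r mulr0.
by move/eqP; rewrite oppr_eq0 => /eqP.
Qed.

Lemma prod_gen_reg (s : seq 'I_n) y : \prod_(i <- s) G i * y = 0 -> y = 0.
Proof.
elim: s => [|i s IHs]; first by rewrite big_nil mul1r.
by rewrite big_cons -mulrA => /gen_reg.
Qed.

Lemma vec_anticomm u j : vec u * G j + G j * vec u = (- 2 * u j)%:A.
Proof.
rewrite mulr_suml mulr_sumr -big_split /= (bigD1 j) //= big1 => [|k kj].
  by rewrite -scalerAl -scalerAr -scalerDr G_clifford eqxx mulr1 addr0 scalerA mulrC.
by rewrite -scalerAl -scalerAr -scalerDr G_clifford (negPf kj) mulr0 scale0r scaler0.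
Qed.

(** The anticommutator with [G j] extracts the [j]-th coefficient, up to the factor -2; this gives
    the linear independence of the generators. *)
Lemma vec_inj u v : vec u = vec v -> u =1 v.
Proof.
move=> uv j; have := vec_anticomm u j; rewrite uv vec_anticomm => /alg_inj.
by move/mulfI => -> //; rewrite oppr_eq0 pnatr_eq0.
Qed.

Lemma anticomm_prod_gen x (s : seq 'I_n) :
  (forall i, x * G i = - (G i * x)) ->
  x * \prod_(i <- s) G i = (-1) ^+ size s * (\prod_(i <- s) G i * x).
Proof.
move=> xG; elim: s => [|i s IHs]; first by rewrite big_nil expr0 mulr1 !mul1r.
rewrite big_cons mulrA xG mulNr -[G i * x * _]mulrA IHs /= exprS mulN1r mulNr.
by rewrite [G i * (_ * _)]mulrA [G i * _ ^+ _]commr_sign !mulrA.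
Qed.

(** Each factor passed costs a sign, except [G j] itself, which occurs at most once. The exponent
    [size s - (j \in s)] is written with a plus, having the same parity. *)
Lemma gen_prod_gen j (s : seq 'I_n) : uniq s ->
  G j * \prod_(i <- s) G i =
  (-1) ^+ (size s + (j \in s)) * (\prod_(i <- s) G i * G j).
Proof.
elim: s => [|i s IHs] /=; first by rewrite big_nil expr0 mulr1 !mul1r.
move=> /andP[is_ /IHs {}IHs]; rewrite big_cons in_cons.
have [eq_ji|ji] /= := eqVneq j i.
  have js : (j \in s) = false by apply/negbTE; rewrite eq_ji.
  rewrite -eq_ji [in LHS]IHs js addn0 addn1 !exprS !mulN1r opprK.
  by rewrite [LHS]mulrA [G j * _ ^+ _]commr_sign !mulrA.
rewrite mulrA gen_anticomm // mulNr -[G i * G j * _]mulrA IHs addSn exprS mulN1r mulNr.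
by rewrite [G i * (_ * _)]mulrA [G i * _ ^+ _]commr_sign !mulrA.
Qed.

(** Replaces the product over ordinals by one over a duplicate-free list, to which the list
    inductions above apply. *)
Lemma volume_enum : exists s : seq 'I_n,
  [/\ uniq s, size s = n, forall j, j \in s & volume = \prod_(i <- s) G i].
Proof.
have [s s_prod [s_uniq s_mem] [_ s_size]] := big_enumP (@predT 'I_n).
by exists s; split; rewrite ?s_size ?card_ord // => j; rewrite s_mem.
Qed.

Lemma volume_reg y : volume * y = 0 -> y = 0.
Proof. by have [s [_ _ _ ->]] := volume_enum; apply: prod_gen_reg. Qed.

Lemma anticomm_volume x :
  (forall i, x * G i = - (G i * x)) -> x * volume = (-1) ^+ n * (volume * x).
Proof.
have [s [_ s_size _ ->]] := volume_enum => /anticomm_prod_gen ->.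
by rewrite s_size.
Qed.

Lemma gen_volume j : G j * volume = (-1) ^+ n.+1 * (volume * G j).
Proof.
have [s [s_uniq s_size s_mem ->]] := volume_enum.
by rewrite gen_prod_gen // s_mem addn1 s_size.
Qed.

(** * Quadratic elements and their commutators with generators *)

Definition cl2 (M : 'M[K]_n) : A := \sum_k \sum_i M k i *: (G k * G i).

Lemma commutator_mul (b x y : A) :
  b * (x * y) - x * y * b = (b * x - x * b) * y + x * (b * y - y * b).
Proof. by rewrite mulrBl mulrBr !mulrA addrA subrK. Qed.

Lemma comm_gen2 k i j :
  G k * G i * G j - G j * (G k * G i) =
  (- 2 * (i == j)%:R) *: G k + (2 * (k == j)%:R) *: G i.
Proof.
have := G_clifford i j; move/(canRL (addrK _)) => Gij.
have := G_clifford k j; move/(canRL (addKr _)) => Gjk.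
rewrite mulrA Gjk -mulrA Gij mulrBr mulrDl mulNr !mulrA -scalerAr mulr1 -scalerAl mul1r.
by rewrite (mulNr (G k * G j)) opprD opprK addrA subrK -scaleNr !mulNr opprK.
Qed.

Lemma comm_cl2 (M : 'M[K]_n) j :
  cl2 M * G j - G j * cl2 M = (-2) *: vec (M^~ j) + 2 *: vec (M j).
Proof.
rewrite /cl2 /vec mulr_suml mulr_sumr -sumrB.
under eq_bigr => k _.
  rewrite mulr_suml mulr_sumr -sumrB.
  under eq_bigr => i _.
    rewrite -scalerAl -scalerAr -scalerBr comm_gen2 scalerDr !scalerA.
  over.
  rewrite big_split /=; over.
rewrite big_split /=; congr (_ + _).
  rewrite scaler_sumr; apply: eq_bigr => k _.
  rewrite (bigD1 j) //= big1 ?addr0 => [|i /negPf ->]; last by rewrite !mulr0 scale0r.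
  by rewrite eqxx mulr1 scalerA mulrC.
rewrite (bigD1 j) //= [X in _ + X]big1 ?addr0 => [|k /negPf kj].
  by rewrite scaler_sumr; apply: eq_bigr => i _; rewrite eqxx mulr1 scalerA mulrC.
by apply: big1 => i _; rewrite kj !mulr0 scale0r.
Qed.

(** For skew [M], row [j] is minus column [j], so the two terms of [comm_cl2] add up to -4 times the
    column; the factor makes the commutator act exactly as [M]. *)
Definition spin (M : 'M[K]_n) : A := (- 4^-1) *: cl2 M.

Lemma comm_spin (M : 'M[K]_n) j :
  M^T = - M -> spin M * G j - G j * spin M = vec (M^~ j).
Proof.
move=> skM; rewrite -scalerAl -scalerAr -scalerBr comm_cl2.
have -> : vec (M j) = - vec (M^~ j).
  by rewrite -sumrN; apply: eq_bigr => k _; rewrite -scaleNr -[in LHS](trmxK M) skM !mxE.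
rewrite scalerN -scaleNr -scalerDl -opprD -natrD scalerA mulrNN mulVf ?scale1r //.
by rewrite pnatr_eq0.
Qed.

(** * Consequences of Schur's lemma: the shape of a linear pair *)

Section Schur.

Hypothesis G_schur : forall x, (forall i, x * G i = G i * x) -> exists k, x = k%:A.

(** For odd [n] the volume element is central, hence scalar, yet it anticommutes with [x]; being
    regular, it forces [x = 0]. For even [n] it anticommutes with the generators, so its square and
    [x * volume] are central, hence scalars, and [x] is solved for. *)
Lemma anticomm_gen x : (forall i, x * G i = - (G i * x)) ->
  exists2 k, (odd n -> k = 0) & x = k *: volume.
Proof.
move=> xG; have xV := anticomm_volume xG.
have [oddn|evenn] := boolP (odd n).
  have [m Vm] : exists m, volume = m%:A.
    by apply: G_schur => i; rewrite gen_volume -signr_odd /= oddn mul1r.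
  exists 0 => //; rewrite scale0r; apply: volume_reg.
  move: xV; rewrite -signr_odd oddn mulN1r Vm -scalerAl -scalerAr mulr1 mul1r.
  move/eqP; rewrite -addr_eq0 -mulr2n -scaler_nat scaler_eq0 pnatr_eq0 /=.
  by move/eqP.
have GV j : volume * G j = - (G j * volume).
  by rewrite gen_volume -signr_odd /= evenn mulN1r opprK.
have [m Vm] : exists m, volume * volume = m%:A.
  by apply: G_schur => i; rewrite -mulrA GV mulrN [in LHS]mulrA GV mulNr opprK mulrA.
have [l xl] : exists l, x * volume = l%:A.
  by apply: G_schur => i; rewrite -mulrA GV mulrN [in LHS]mulrA xG mulNr opprK mulrA.
have m0 : m != 0.
  (* If the square vanished, regularity would give [volume = 0] and then [1 = 0]. *)
  apply/eqP => m0; move: Vm; rewrite m0 scale0r => /volume_reg V0.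
  have : volume * 1 = 0 by rewrite V0 mul0r.
  by move/volume_reg/eqP; rewrite oner_eq0.
exists (l / m) => //.
have : m *: x = l *: volume.
  by rewrite -[m *: x]mulr_algr -Vm -[l *: _]mulr_algl -xl mulrA.
move/(congr1 (fun y => m^-1 *: y)); rewrite !scalerA mulVf // scale1r => ->.
by rewrite mulrC.
Qed.

Lemma linear_pair_structure (a b : A) (L : 'M[K]_n) :
    (forall j, a * G j - G j * b = vec (L^~ j)) ->
  exists g l k (M : 'M[K]_n),
    [/\ M^T = - M, L = M + g%:M, odd n -> k = 0,
        a = spin M + (g + l)%:A + k *: volume & b = spin M + l%:A - k *: volume].
Proof.
move=> abL; have [d dab] : exists d, d = a - b by exists (a - b).
have dG i : d * G i = (2 * L i i) *: G i - G i * d.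
  (* Sandwich the hypothesis between two copies of [G i] and use that [G i] squares to -1. *)
  have Gba : G i * a - b * G i = - (G i * (vec (L^~ i) * G i)).
    rewrite -abL mulrBl -[a * _ * _]mulrA gen_sqr mulrN1 mulrBr mulrN !mulrA.
    by rewrite gen_sqr mulN1r mulNr opprD !opprK.
  have vG : vec (L^~ i) * G i = (- 2 * L i i)%:A - G i * vec (L^~ i).
    by rewrite -(vec_anticomm (L^~ i)) addrK.
  apply/eqP; rewrite -subr_eq opprK; apply/eqP.
  have -> : d * G i + G i * d = (a * G i - G i * b) + (G i * a - b * G i).
    by rewrite dab mulrBl mulrBr [LHS]addrACA [RHS]addrACA; congr (_ + _); apply: addrC.
  rewrite Gba abL vG mulrBr mulrA gen_sqr mulN1r opprK -scalerAr mulr1.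
  by rewrite mulNr scaleNr opprD opprK addrCA subrr addr0.
have dGG i j : d * (G i * G j) = (2 * (L i i - L j j)) *: (G i * G j) + G i * G j * d.
  rewrite (mulrBr 2) scalerBl [LHS]mulrA dG mulrBl -scalerAl.
  by rewrite -[G i * d * _]mulrA dG mulrBr -scalerAr opprB addrA addrAC mulrA.
(* Swapping [i] and [j] changes the sign of the product and of the coefficient in [dGG]. Comparing
   the two expressions leaves a multiple of [L i i - L j j] times the regular element
   [G i * G j]. *)
have Ldiag i j : L i i = L j j.
  have [->//|ij] := eqVneq i j.
  have := dGG i j; rewrite [in LHS]gen_anticomm // mulrN dGG.
  rewrite -[G j * G i]opprK -gen_anticomm // scalerN mulNr opprD !opprK.
  move/addIr/eqP; rewrite -subr_eq0 -scalerBl scaler_eq0.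
  rewrite -mulrBr opprB -mulr2n => /orP[|/eqP/gen_reg].
    by rewrite mulf_eq0 !mulrn_eq0 oner_eq0 /= subr_eq0 => /eqP ->.
  by rewrite -[G j]mulr1 => /gen_reg/eqP; rewrite oner_eq0.
have [g Lg] : exists g, forall i, L i i = g.
  have [/= i _|n0] := pickP 'I_n; first by exists (L i i).
  (* When [n = 0] there are no diagonal entries, and any scalar would do. *)
  by exists 0 => i; have := n0 i.
have [k k0 dk] : exists2 k, odd n -> k = 0 & d - g%:A = k *: volume.
  apply: anticomm_gen => i; rewrite mulrBl dG Lg mulr_algl mulrBr mulr_algr opprB.
  by rewrite addrAC -scalerBl mulr_natl mulr2n addrK.
have dE : d = k *: volume + g%:A by rewrite -dk subrK.
have kV i : (k / 2) *: (volume * G i) = - ((k / 2) *: (G i * volume)).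
  have [oddn|evenn] := boolP (odd n); first by rewrite k0 // mul0r !scale0r oppr0.
  by rewrite gen_volume -signr_odd /= evenn mulN1r scalerN opprK.
(* The volume part of [a - b] is shared equally, with opposite signs, to match the shape of the
   normalization. *)
have [b' bE] : exists b', b = b' - (k / 2) *: volume.
  by exists (b + (k / 2) *: volume); rewrite addrK.
have aE : a = b' + g%:A + (k / 2) *: volume.
  have -> : a = b + d by rewrite dab addrC subrK.
  rewrite bE dE [_ + g%:A]addrC addrA [b' - _ + _]addrAC -[LHS]addrA; congr (_ + _).
  by rewrite -scaleNr -scalerDl {2}[k](splitr k) addKr.
have [M LM] : exists M : 'M_n, L = M + g%:M by exists (L - g%:M); rewrite subrK.
have bM j : b' * G j - G j * b' = vec (M^~ j).
  have : vec (L^~ j) = vec (M^~ j) + g *: G j.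
    rewrite /vec [in RHS](bigD1 j) //= [LHS](bigD1 j) //= LM !mxE eqxx scalerDl.
    rewrite addrAC; congr (_ + _ + _); apply: eq_bigr => i /negPf ij.
    by rewrite !mxE ij addr0.
  rewrite -abL aE bE !mulrDl mulrBr mulr_algl -scalerAl -scalerAr kV opprB.
  by rewrite addrA subrK addrAC => /addIr.
have skM : M^T = - M.
  apply/matrixP => i j; rewrite !mxE.
  (* The two Leibniz identities are added: the left side becomes the commutator of [b'] with a
     scalar, hence 0, and the right side becomes -2 times [M i j + M j i]. *)
  have := commutator_mul b' (G i) (G j); have := commutator_mul b' (G j) (G i).
  rewrite !bM => Eji Eij; move: (f_equal2 +%R Eij Eji).
  rewrite [LHS]addrACA -opprD -mulrDl -mulrDr G_clifford mulr_algl mulr_algr subrr.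
  rewrite [vec (M^~ j) * _ + _]addrC [RHS]addrACA vec_anticomm.
  rewrite [_ + vec (M^~ j) * _]addrC vec_anticomm -scalerDl -mulrDr => /esym/eqP.
  rewrite scaler_eq0 oner_eq0 orbF mulf_eq0 oppr_eq0 (pnatr_eq0 K 2) /= addr_eq0.
  by move/eqP.
(* Both elements have the same commutator with every generator, so their difference is central. *)
have [l bl] : exists l, b' - spin M = l%:A.
  apply: G_schur => i; apply/eqP; rewrite -subr_eq0 mulrBl mulrBr opprB.
  rewrite [_ - G i * b']addrC addrACA bM [- _ + _]addrC -[_ - spin M * _]opprB.
  by rewrite comm_spin // subrr.
have b'E : b' = spin M + l%:A by rewrite -bl addrC subrK.
exists g, l, (k / 2), M; split=> //.
- by move=> /k0 ->; rewrite mul0r.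
- by rewrite aE b'E [g + l]addrC scalerDl addrA.
by rewrite bE b'E.
Qed.

End Schur.
End CliffordGenerators.

(** * Endomorphisms under composition as an algebra *)

Section EndAlgebra.

Variables (K : fieldType) (S : vectType K).
Hypothesis S_proper : (0 < dim S)%N.

(* Unlike the library's lfun_algType, the product here is \o and not its converse. *)
Definition end_nzRing : nzRingType := lfun_comp_nzRingType S_proper.
Definition end_lalg : lalgType K := HB.pack 'End(S) end_nzRing
  (GRing.Lmodule_isLalgebra.Build K end_nzRing (@comp_lfunZl K S S S)).
Definition end_alg : algType K := HB.pack 'End(S) end_lalg
  (GRing.Lalgebra_isAlgebra.Build K end_lalg (@comp_lfunZr K S S S)).

End EndAlgebra.

(** * Eigenvalues over an algebraically closed field *)

Section ClosedField.

Import passmx.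

Variables (K : closedFieldType) (S : vectType K).

Lemma exists_eigenvalue (f : 'End(S)) : (0 < \dim {:S})%N ->
  exists k, lker (f - k *: \1%VF) != 0%VS.
Proof.
move=> S_gt0; pose e := vbasis {:S}; have e_basis := vbasisP {:S}.
(* The size of a polynomial is its degree plus one, so this says that the degree [\dim {:S}] is
   nonzero. *)
have /closed_rootP[k] : size (char_poly (mxof e e f)) != 1%N.
  by rewrite size_char_poly eqSS -lt0n.
rewrite -eigenvalue_root_char => /eigenvalueP[v /esym vk v0]; exists k.
apply: contraNneq v0 => ker0.
rewrite -(vecof_eq0 e_basis) -memv0 -ker0 memv_ker !lfun_simp.
by rewrite (hom_vecof e e_basis) -vk linearZ subrr.
Qed.

End ClosedField.

(** Transposition changes only the sign of the middle term of M^2 + 2kM + k^2, while the right side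
    is symmetric; hence 4kM = 0. When k = 0, realness of M^2 says that its imaginary part, the
    anticommutator, vanishes. *)
Lemma skew_shift_sqr (R : rcfType) n (M : 'M[R[i]]_n) (k : R[i]) (Q : 'M[R]_n)
    (M0 := map_mx (@complex.Re R) M) (M1 := map_mx (@complex.Im R) M) :
    M^T = - M -> Q^T = Q ->
    (M + k%:M) *m (M + k%:M) = map_mx (real_complex R) Q ->
  M = 0 \/ k = 0 /\ M0 *m M1 + M1 *m M0 = 0.
Proof.
move=> skM symQ sqrM.
have kM : k *: M = 0.
  have /(congr1 trmx) := sqrM; rewrite map_trmx symQ -sqrM trmx_mul linearD /=.
  rewrite tr_scalar_mx skM !(mulmxDl, mulmxDr) mulNmx mulmxN opprK.
  rewrite mul_mx_scalar mul_scalar_mx -!addrA => /addrI.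
  rewrite !addrA => /addIr; rewrite mul_mx_scalar mul_scalar_mx scalerN -mulr2n.
  rewrite -[RHS]mulr2n mulNrn => /esym/eqP; rewrite -addr_eq0 -mulr2n -mulrnA.
  by rewrite -scaler_nat scaler_eq0 pnatr_eq0 /= => /eqP.
move/eqP: (kM); rewrite scaler_eq0 => /orP[/eqP k0|/eqP M_eq0]; last by left.
right; split=> //; apply/matrixP => i j.
have := congr1 (fun B : 'M_n => complex.Im (B i j)) sqrM.
rewrite k0 raddf0 !addr0 !mxE raddf_sum /= => sum0.
rewrite -[RHS]sum0 -big_split /=; apply: eq_bigr => l _; rewrite !mxE.
by case: (M i l) (M l j) => [x y] [x' y'] /=; rewrite addrC.
Qed.

(** * The irreducible Clifford representation on [S] *)

Section CliffordRepresentation.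

Variables (R : realType) (n : nat) (V : vectType R) (S : vectType R[i]).
Variables (g : {dot V for idfun}) (e : n.-tuple V).
Variable c : {linear V -> 'End(S) | real_complex R \; *:%R}.
Hypothesis g_e : orthonormal_basis g e.
Hypothesis c_clifford : clifford_map g c.

Let e_basis : basis_of {:V} e := proj1 g_e.
Let G : 'I_n -> 'End(S) := Gamma e c.
(** This is [Gamma_star] without its power of i. *)
Let volume : 'End(S) := \big[@comp_lfun _ S S S / \1%VF]_(i < n) G i.

Lemma Gamma_clifford i j :
  ((G i \o G j) + (G j \o G i))%VF = (- 2 * (i == j)%:R) *: \1%VF.
Proof.
by rewrite c_clifford (proj2 g_e) rmorphM rmorphN !rmorph_nat.
Qed.

Lemma basis_expand v : v = \sum_i coord e i v *: tnth e i.
Proof.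
rewrite [LHS](coord_basis e_basis) ?memvf //.
by apply: eq_bigr => i _; rewrite (tnth_nth 0).
Qed.

Lemma c_expand v : c v = \sum_i (coord e i v)%:C%C *: G i.
Proof.
by rewrite {1}[v]basis_expand linear_sum; apply: eq_bigr => i _; rewrite linearZ.
Qed.

Lemma mem_VC x : reflect (exists u : 'I_n -> R[i], x = \sum_i u i *: G i) (x \in VC e c).
Proof.
apply: (iffP idP) => [|[u ->]]; last first.
  by apply: memv_suml => i _; apply: memvZ; apply: memv_span; apply: image_f.
rewrite /VC span_def big_image => /memv_sumP[y yG ->].
have /fin_all_exists[u yE] : forall i, exists k, y i = k *: G i.
  by move=> i; apply/vlineP; apply: yG.
by exists u; apply: eq_bigr => i _.
Qed.

Lemma c_VC v : c v \in VC e c.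
Proof. by apply/mem_VC; exists (fun i => (coord e i v)%:C%C); apply: c_expand. Qed.

Lemma s_map_linear (a b : 'End(S)) (I : finType) (u : I -> R[i]) (x : I -> 'End(S)) :
  s_map a b (\sum_i u i *: x i) = \sum_i u i *: s_map a b (x i).
Proof.
apply/lfunP => w; rewrite /s_map !(lfun_simp, linear_sum) /=. rewrite -big_split /=.
apply: eq_bigr => i _; rewrite !lfun_simp linearZ /=.
by rewrite scalerBr.
Qed.

Lemma linear_pair_gen (a b : 'End(S)) :
  (forall i, s_map a b (G i) \in VC e c) -> linear_pair e c a b.
Proof.
move=> abG _ /mem_VC[u ->]; rewrite s_map_linear.
by apply: memv_suml => i _; apply: memvZ.
Qed.

Lemma dotC v w : g v w = g w v.
Proof. by rewrite (@hermC _ _ _ _ g) expr0 mul1r. Qed.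

Lemma dot_sum_basis (u : 'I_n -> R) j : g (\sum_i u i *: tnth e i) (tnth e j) = u j.
Proof.
rewrite linear_sumlz (bigD1 j) //= linearZl /= (proj2 g_e) eqxx.
rewrite mulr1 big1 ?addr0 // => i /negPf ij.
by rewrite linearZl /= (proj2 g_e) ij mulr0.
Qed.

Lemma coord_dot i v : coord e i v = g v (tnth e i).
Proof. by rewrite [in RHS](basis_expand v) dot_sum_basis. Qed.

Lemma linear_basis (M : 'M[R]_n) :
  exists T : 'End(V), forall i, T (tnth e i) = \sum_k M k i *: tnth e k.
Proof.
have [f fE] := linear_of_free e [seq \sum_k M k i *: tnth e k | i <- enum 'I_n].
exists (linfun f) => i; rewrite lfunE /=.
have := fE (basis_free e_basis).
rewrite size_map size_enum_ord size_tuple => /(_ erefl) mapE.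
have := congr1 (fun s => nth 0 s i) mapE.
by rewrite (nth_map 0) ?size_tuple // (nth_map i) ?size_enum_ord // nth_ord_enum -tnth_nth.
Qed.

(** In an orthonormal basis the entries of [M] are the values [g (T e_i) e_j], so skewness passes
    from the matrix to the bilinear form. *)
Lemma skew_symmetric_basis (T : 'End(V)) (M : 'M[R]_n) :
  (forall i, T (tnth e i) = \sum_k M k i *: tnth e k) -> M^T = - M ->
  skew_symmetric g T.
Proof.
move=> TE skM v w.
have TG i j : g (T (tnth e i)) (tnth e j) = M j i by rewrite TE dot_sum_basis.
have gE x y : g (T x) y = \sum_i \sum_j coord e i x * (coord e j y * M j i).
  rewrite {1}(basis_expand x) linear_sum linear_sumlz; apply: eq_bigr => i _.
  rewrite linearZ linearZl /= {1}(basis_expand y) linear_sumr mulr_sumr; apply: eq_bigr => j _.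
  by rewrite linearZr /= TG.
rewrite gE [g v _]dotC gE exchange_big -sumrN; apply: eq_bigr => i _ /=.
rewrite -sumrN; apply: eq_bigr => j _; rewrite mulrCA -!mulrN.
by rewrite -[M in LHS]trmxK skM !mxE.
Qed.

(** The element [spin] spelled out with [\o]; it is convertible to [spin] in [end_alg], so the
    abstract results apply directly. *)
Let spinE (M : 'M[R[i]]_n) : 'End(S) :=
  (- 4^-1) *: \sum_k \sum_i M k i *: (G k \o G i)%VF.

Lemma spin_Cl2 (M : 'M[R[i]]_n) : (forall i, M i i = 0) -> spinE M \in Cl2 e c.
Proof.
move=> M0; apply: memvZ; apply: memv_suml => k _; apply: memv_suml => i _.
have [->|ik] := eqVneq i k; first by rewrite M0 scale0r mem0v.
apply/memvZ/memv_span/allpairsPdep; exists k, i.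
by rewrite mem_enum mem_filter mem_enum ik.
Qed.

Hypothesis c_irr : irreducible_rep c.

Lemma S_proper : (0 < dim S)%N.
Proof. by have [] := c_irr; rewrite dimvf. Qed.

Let A := end_alg S_proper.

Lemma comm_spinE (M : 'M[R[i]]_n) i : M^T = - M ->
  s_map (spinE M) (spinE M) (G i) = \sum_k M k i *: G k.
Proof. exact: (@comm_spin _ A n G Gamma_clifford M i). Qed.

Lemma Gamma_inj (u v : 'I_n -> R[i]) :
  \sum_k u k *: G k = \sum_k v k *: G k -> u =1 v.
Proof. exact: (@vec_inj _ A n G Gamma_clifford). Qed.

Lemma Gamma_volume i : (G i \o volume)%VF = (-1) ^+ n.+1 *: (volume \o G i)%VF.
Proof.
have := @gen_volume _ A n G Gamma_clifford i.
rewrite -signr_odd => GV; rewrite -signr_odd; move: GV.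
case: (odd n.+1); first by rewrite expr1 mulN1r scaleN1r.
by rewrite expr0 mul1r scale1r.
Qed.

(** An eigenspace of [f] is nonzero and stable under every [c v], since [f] commutes with the
    generators; irreducibility makes it all of [S]. *)
Lemma schur (f : 'End(S)) :
  (forall i, (f \o G i)%VF = (G i \o f)%VF) -> exists k, f = k *: \1%VF.
Proof.
move=> fG; have [S_gt0 S_irr] := c_irr.
have [k ker_neq0] := exists_eigenvalue f S_gt0; exists k.
have [v|ker0|kerT] := S_irr (lker (f - k *: \1%VF)).
- apply/subvP => _ /memv_imgP[w wk ->]; move: wk; rewrite !memv_ker !lfun_simp /=.
  rewrite c_expand !lfun_simp !subr_eq0 => /eqP fw.
  rewrite linear_sum scaler_sumr; apply/eqP/eq_bigr => i _.
  rewrite !lfun_simp linearZ /= scalerA mulrC -scalerA; congr (_ *: _).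
  by rewrite -comp_lfunE fG comp_lfunE fw linearZ.
- by rewrite ker0 eqxx in ker_neq0.
apply/eqP; rewrite -subr_eq0; apply/eqP/lfunP => w.
by rewrite zero_lfunE; apply/eqP; rewrite -memv_ker kerT memvf.
Qed.

Lemma End_linear_pair_structure (a b : 'End(S)) (L : 'M[R[i]]_n) :
    (forall j, s_map a b (G j) = \sum_k L k j *: G k) ->
  exists l m k (M : 'M[R[i]]_n),
    [/\ M^T = - M, L = M + l%:M, odd n -> k = 0,
        a = spinE M + (l + m) *: \1%VF + k *: volume
      & b = spinE M + m *: \1%VF - k *: volume].
Proof. exact: (@linear_pair_structure _ A n G Gamma_clifford schur a b L). Qed.

Lemma s_mapD (a a' b b' x : 'End(S)) :
  s_map (a + a') (b + b') x = s_map a b x + s_map a' b' x.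
Proof. by rewrite /s_map comp_lfunDl comp_lfunDr opprD addrACA. Qed.

Lemma s_mapZ k (a b x : 'End(S)) : s_map (k *: a) (k *: b) x = k *: s_map a b x.
Proof. by rewrite /s_map -comp_lfunZl -comp_lfunZr scalerBr. Qed.

Lemma s_map_scalar (k l : R[i]) (x : 'End(S)) : s_map (k *: \1%VF) (l *: \1%VF) x = (k - l) *: x.
Proof.
by rewrite /s_map -comp_lfunZl -comp_lfunZr comp_lfun1l comp_lfun1r scalerBl.
Qed.

Lemma s_map_volume (k : R[i]) i :
  ~~ odd n -> s_map (k *: volume) (- (k *: volume)) (G i) = 0.
Proof.
move=> evenn; rewrite /s_map comp_lfunNr opprK -comp_lfunZl -comp_lfunZr Gamma_volume.
by rewrite -signr_odd /= evenn scaleN1r scalerN subrr.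
Qed.

(** Normalizing does not change [s_map] on generators: equal scalars cancel, and for even [n] the
    element [Gamma_star] anticommutes with each generator. *)
Lemma linear_up_to_normalization (P : 'End(S) -> 'End(S) -> Prop) a b :
  (forall a' b', P a' b' -> linear_pair e c a' b') ->
  up_to_normalization e c P a b -> linear_pair e c a b.
Proof.
move=> linP Pab; apply: linear_pair_gen => i.
have GVC : G i \in VC e c by apply/memv_span/image_f.
move: Pab; rewrite /up_to_normalization; case: ifPn => [oddn [al]|evenn [al [al1]]].
  by move=> /linP/(_ _ GVC); rewrite s_mapD s_map_scalar subrr scale0r addr0.
move=> /linP/(_ _ GVC); rewrite !s_mapD s_map_scalar subrr scale0r addr0.
by rewrite scalerA s_map_volume // addr0.
Qed.

Lemma up_to_normalization_intro (P : 'End(S) -> 'End(S) -> Prop) a b al k :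
  (odd n -> k = 0) -> P a b ->
  up_to_normalization e c P
    (a + al *: \1%VF + k *: volume) (b + al *: \1%VF - k *: volume).
Proof.
move=> k0 Pab; rewrite /up_to_normalization; case: ifPn => [oddn|evenn].
  exists (- al); rewrite k0 // scale0r oppr0 !addr0 scaleNr.
  by rewrite !addrK.
have i0 : 'i%C ^+ (n.+1)./2 != 0 :> R[i] by rewrite expf_neq0 // neq0Ci.
(* The signs undo the added terms; the division converts a multiple of [volume] into one of
   [Gamma_star]. *)
exists (- al), (- (k / 'i%C ^+ (n.+1)./2)).
rewrite scalerA mulNr divfK // !scaleNr -/volume opprK.
by rewrite [a + _ + _ + _]addrAC [b + _ + _ + _]addrAC !addrK subrK.
Qed.

Lemma Cl2_real_spin (M : 'M[R]_n) : M^T = - M ->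
  exists2 T : 'End(V), (forall i, T (tnth e i) = \sum_k M k i *: tnth e k) &
    Cl2_real g e c (spinE (map_mx (real_complex R) M)) T.
Proof.
move=> skM; have [T TE] := linear_basis M; exists T => //.
have skMC : (map_mx (real_complex R) M)^T = - map_mx (real_complex R) M.
  by rewrite map_trmx skM map_mxN.
split; first last.
- move=> v; rewrite -/(s_map _ _ _) c_expand s_map_linear {2}(basis_expand v) !linear_sum.
  apply: eq_bigr => i _; rewrite comm_spinE // !linearZ /= TE.
  by congr (_ *: _); rewrite linear_sum; apply: eq_bigr => k _; rewrite linearZ !mxE.
- exact: skew_symmetric_basis TE skM.
apply: spin_Cl2 => i; rewrite mxE.
have /matrixP/(_ i i)/eqP := skM; rewrite !mxE -addr_eq0 -mulr2n mulrn_eq0 /=.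
by move/eqP=> ->; rewrite rmorph0.
Qed.

Lemma spinE_complex (M : 'M[R[i]]_n) :
  spinE M = spinE (map_mx (real_complex R) (map_mx (@complex.Re R) M))
            + 'i%C *: spinE (map_mx (real_complex R) (map_mx (@complex.Im R) M)).
Proof.
rewrite /spinE scalerA mulrC -scalerA -scalerDr; congr (_ *: _).
rewrite scaler_sumr -big_split; apply: eq_bigr => k _ /=.
rewrite scaler_sumr -big_split; apply: eq_bigr => i _ /=.
by rewrite !mxE scalerA -scalerDl -complexE.
Qed.

Lemma anticommuting_spin (M : 'M[R[i]]_n)
    (M0 := map_mx (@complex.Re R) M) (M1 := map_mx (@complex.Im R) M) :
  M^T = - M -> M0 *m M1 + M1 *m M0 = 0 ->
  anticommuting_form g e c (spinE M) (spinE M).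
Proof.
move=> skM M01.
have skM0 : M0^T = - M0 by rewrite map_trmx skM; apply/matrixP => i j; rewrite !mxE raddfN.
have skM1 : M1^T = - M1 by rewrite map_trmx skM; apply/matrixP => i j; rewrite !mxE raddfN.
have [T0 T0E cl0] := Cl2_real_spin skM0; have [T1 T1E cl1] := Cl2_real_spin skM1.
exists (spinE (map_mx (real_complex R) M0)), (spinE (map_mx (real_complex R) M1)), T0, T1.
split=> //; try exact: spinE_complex.
(* Images of basis vectors are columns, so composition becomes the matrix product in the same
   order. *)
have comp (N N' : 'M[R]_n) (U U' : 'End(V)) i :
    (forall i, U (tnth e i) = \sum_k N k i *: tnth e k) ->
    (forall i, U' (tnth e i) = \sum_k N' k i *: tnth e k) ->
  U (U' (tnth e i)) = \sum_k (N *m N') k i *: tnth e k.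
  move=> UE U'E; rewrite U'E linear_sum.
  under [RHS]eq_bigr do rewrite mxE scaler_suml.
  rewrite exchange_big; apply: eq_bigr => l _ /=.
  rewrite linearZ /= UE scaler_sumr; apply: eq_bigr => k _.
  by rewrite scalerA mulrC.
apply/lfunP => v; rewrite {1}(basis_expand v) linear_sum zero_lfunE big1 // => i _.
rewrite linearZ /= !lfun_simp (comp M0 M1) // (comp M1 M0) // -big_split.
rewrite big1 ?scaler0 //= => k _.
by move/matrixP/(_ k i): M01; rewrite !mxE -scalerDl => ->; rewrite scale0r.
Qed.

Lemma spinE0 : spinE 0 = 0.
Proof.
rewrite /spinE big1 ?scaler0 // => k _; rewrite big1 // => i _.
by rewrite mxE scale0r.
Qed.

Lemma linear_pair_matrix (a b : 'End(S)) : linear_pair e c a b ->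
  exists L : 'M[R[i]]_n, forall j, s_map a b (G j) = \sum_k L k j *: G k.
Proof.
move=> ab_lin.
have /fin_all_exists[u uE] : forall j, exists u : 'I_n -> R[i],
    s_map a b (G j) = \sum_k u k *: G k.
  by move=> j; apply/mem_VC/ab_lin/memv_span/image_f.
exists (\matrix_(k, j) u j k) => j; rewrite uE.
by apply: eq_bigr => k _; rewrite mxE.
Qed.

(** On generators [q_map] has matrix [L *m L]. It also has the real matrix of [Q] in the orthonormal
    basis, which is symmetric because [Q] is; independence of the generators equates the two. *)
Lemma quadratic_pair_sqr (a b : 'End(S)) (L : 'M[R[i]]_n) :
    quadratic_pair g c a b ->
    (forall j, s_map a b (G j) = \sum_k L k j *: G k) ->
  exists2 N : 'M[R]_n, N^T = N & L *m L = map_mx (real_complex R) N.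
Proof.
case=> Q qQ symQ LE; exists (\matrix_(k, j) coord e k (Q (tnth e j))).
  by apply/matrixP => i j; rewrite !mxE !coord_dot symQ dotC.
apply/matrixP => k j; move: k; apply: Gamma_inj.
under [RHS]eq_bigr do rewrite !mxE.
rewrite -c_expand -qQ /q_map LE s_map_linear.
under eq_bigr do rewrite mxE scaler_suml.
rewrite exchange_big; apply: eq_bigr => l _ /=.
rewrite LE scaler_sumr; apply: eq_bigr => k _.
by rewrite scalerA mulrC.
Qed.

End CliffordRepresentation.

Theorem proposition2p16 (R : realType) (n : nat) (V : vectType R)
    (S : vectType R[i]) (g : {dot V for idfun})
    (c : {linear V -> 'End(S) | real_complex R \; *:%R})
    (e : n.-tuple V)
    (g_e : orthonormal_basis g e) (c_clifford : clifford_map g c)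
    (c_irr : irreducible_rep c)
    (a b : 'End(S)) (ab_quadratic : quadratic_pair g c a b) :
  linear_pair e c a b <->
  up_to_normalization e c
    (fun a' b' => scalar_form a' b' \/ anticommuting_form g e c a' b') a b.
Proof.
split=> [/(linear_pair_matrix)[L LE]|].
  have [N symN LLN] := quadratic_pair_sqr g_e c_clifford c_irr ab_quadratic LE.
  have [l [m [k [M [skM LM k0 -> ->]]]]] :=
    End_linear_pair_structure g_e c_clifford c_irr LE.
  move: LLN; rewrite LM => /(skew_shift_sqr skM symN)[M0|[l0 M01]].
    rewrite M0 spinE0 add0r.
    (* With [M = 0] the pair is, up to its volume part, [(l + m, m)]; removing the common scalar
       [l + m] leaves [(0, - l)]. *)
    have -> : 0 + m *: \1%VF = - l *: \1%VF + (l + m) *: \1%VF :> 'End(S).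
      by rewrite add0r -scalerDl addKr.
    rewrite -[_ *: \1%VF + k *: _]add0r addrA.
    apply: up_to_normalization_intro => //; left.
    by exists (- l).
  rewrite l0 add0r; apply: up_to_normalization_intro => //; right.
  exact: anticommuting_spin.
apply: (linear_up_to_normalization g_e c_clifford c_irr) => a' b' [[be [-> ->]]|].
  move=> x xV; rewrite -(scale0r \1%VF) s_map_scalar; exact: memvZ.
(* The commutator with [A0 + i A1] sends a generator to [c (T0 e_i) + i c (T1 e_i)], which lies in
   [VC]. *)
case=> A0 [A1 [T0 [T1 [[_ _ T0E] [_ _ T1E] _ -> ->]]]].
apply: linear_pair_gen => i.
by rewrite s_mapD s_mapZ [s_map A0 _ _]T0E [s_map A1 _ _]T1E memvD //;
  [|apply: memvZ]; apply: (c_VC c g_e).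
Qed.
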